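(* Let $s_0,\dots,s_{n-1},r_0,\dots,r_{m-1}$ be pairwise distinct variables and let $\phi$ be a cyclic formula modalised in each $r_j$. Then for all cyclic formulas $\psi_i,\chi_i$ ($i<n$) and $\theta_j,\rho_j$ ($j<m$), $\bigwedge_{i<n}\boxdot^\bullet(\psi_i\leftrightarrow\chi_i),\ \bigwedge_{j<m}\Box^\bullet(\theta_j\leftrightarrow\rho_j)\vdash_{\mathsf{CHL}}\phi[\vec s:\vec\psi,\vec r:\vec\theta]\leftrightarrow\phi[\vec s:\vec\chi,\vec r:\vec\rho]$.
   Context: Labels: $\bot,\top$ and propositional variables (arity 0), $\neg,\Box$ (arity 1), $\wedge,\vee,\to$ (arity 2). A graph is $\langle V,r,S,\lambda\rangle$ with $V$ finite, root $r$, labelling $\lambda$, $S:V\to V^{*}$ ordered successors (length = arity of label); every vertex reachable from $r$. A (cyclic) formula is a graph in which every cycle (closed path of pairwise distinct vertices along successors) contains a $\Box$-labelled vertex. Bisimulation: $aRa'$ implies equal labels and $i$-th successors related; $\simeq$ = bisimilarity relating roots. Simultaneous substitution $\phi[\vec s:\vec\psi,\vec r:\vec\theta]$: disjoint union of $\phi$ and the substituted formulas, identifying each $s_i$-labelled (resp. $r_j$-labelled) vertex of $\phi$ with the root of the copy of $\psi_i$ (resp. $\theta_j$), keeping that root's label. $\phi$ modalised in $p$: every path from root to a $p$-labelled vertex contains a $\Box$-labelled vertex; then $\digamma p.\phi$ identifies the root with all $p$-labelled vertices (keeping the root's label). $\mathsf{CHL}$: least set of cyclic formulas containing all substitution instances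 of propositional tautologies, all $\Box(\phi\to\psi)\to(\Box\phi\to\Box\psi)$, all $\phi\leftrightarrow\psi$ with $\phi\simeq\psi$, closed under modus ponens, necessitation and Löb's rule (from $\vdash\Box\phi\to\phi$ infer $\vdash\phi$). $\Gamma\vdash_{\mathsf{CHL}}\phi$ means $\mathsf{CHL}\vdash\bigwedge\Gamma\to\phi$. $\Box^\bullet\phi:=\digamma p.\Box(\phi\wedge p)$ ($p$ not in $\phi$); $\boxdot^\bullet\phi:=\phi\wedge\Box^\bullet\phi$. *)

(* Defs.v *)
From mathcomp Require Import all_boot.

Set Implicit Arguments.
Unset Strict Implicit.
Unset Printing Implicit Defensive.

Inductive label : Type :=
| LBot | LTop | LVar of nat | LNeg | LBox | LAnd | LOr | LImp.

Definition arity (l : label) : nat :=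
  match l with
  | LBot | LTop | LVar _ => 0
  | LNeg | LBox => 1
  | LAnd | LOr | LImp => 2
  end.

Definition is_box (l : label) : bool := if l is LBox then true else false.

Definition is_var (p : nat) (l : label) : bool :=
  if l is LVar q then q == p else false.

(* A pregraph is a graph some of whose vertices may be unreachable from
   the root; it is only an intermediate step in the constructions below. *)
Record pregraph := Pregraph {
  vert : finType;
  groot : vert;
  succs : vert -> seq vert;
  lab : vert -> label;
  size_succs : forall v, size (succs v) = arity (lab v)
}.

Definition edge (G : pregraph) : rel (vert G) := fun u v => v \in succs u.

Definition rooted (G : pregraph) : Prop := forall v, connect (@edge G) (groot G) v.

Definition guarded (G : pregraph) : Prop :=
  forall c : seq (vert G), c != [::] -> ucycle (@edge G) c ->
    has (fun v => is_box (lab v)) c.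

Record cform := Cform {
  graph_of :> pregraph;
  cform_rooted : rooted graph_of;
  cform_guarded : guarded graph_of
}.

Definition bisimulation (G H : pregraph) (R : vert G -> vert H -> Prop) : Prop :=
  forall a b, R a b ->
    lab a = lab b /\
    forall i, i < arity (lab a) -> R (nth a (succs a) i) (nth b (succs b) i).

Definition bisimilar (G H : pregraph) : Prop :=
  exists2 R : vert G -> vert H -> Prop, bisimulation R & R (groot G) (groot H).

Lemma connect_homo (T U : finType) (e : rel T) (e' : rel U) (f : T -> U) x y :
  (forall a b, e a b -> e' (f a) (f b)) ->
  connect e x y -> connect e' (f x) (f y).
Proof.
move=> fe /connectP[s es ->]; apply/connectP; exists (map f s).
  by elim: s x es => //= z s IHs x /andP[/fe-> /IHs->].
by rewrite last_map.
Qed.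

Lemma guarded_embed (G H : pregraph) (f : vert G -> vert H) (x : vert G) c :
  injective f ->
  (forall a b, edge (f a) b -> exists2 a', b = f a' & edge a a') ->
  (forall a, lab (f a) = lab a) ->
  guarded G -> ucycle (@edge H) c -> f x \in c ->
  has (fun v => is_box (lab v)) c.
Proof.
move=> f_inj f_succ f_lab gG uc xc.
have [i c' Dc] := rot_to xc.
have : ucycle (@edge H) (f x :: c') by rewrite -Dc rot_ucycle.
have -> : has (fun v => is_box (lab v)) c =
          has (fun v => is_box (lab v)) (f x :: c') by rewrite -Dc has_rot.
have lift : forall s a, path (@edge H) (f a) s ->
    exists2 s', s = map f s' & path (@edge G) a s'.
  elim=> [|b s IHs] a /=; first by exists [::].
  move=> /andP[/f_succ[a' -> ea]] /IHs[s' -> es'].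
  by exists (a' :: s'); rewrite //= ea.
move=> /andP[/= /lift[s Ds es] uc'].
case: (lastP s) => [|s' y] in Ds es *; first by case: (c') Ds.
rewrite map_rcons in Ds; have [Dc' /f_inj Dy] := rcons_inj Ds.
rewrite -{}Dy {Ds} in es.
have := gG (x :: s') isT; rewrite /ucycle /= es /= => gxs.
move: uc'; rewrite {}Dc' -(mem_map f_inj) in gxs *.
rewrite (map_inj_uniq f_inj) => /gxs.
rewrite f_lab has_map => /orP[->//|/hasP[z zs bz]].
by apply/orP; right; apply/hasP; exists z => //=; rewrite f_lab.
Qed.

Section Generated.

Variable G : pregraph.

Definition gen_vert : finType := {v : vert G | connect (@edge G) (groot G) v}.
Definition gen_root : gen_vert := exist _ (groot G) (connect0 _ _).
Definition gen_succs (v : gen_vert) : seq gen_vert := pmap insub (succs (val v)).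

Lemma val_gen_succs v : map val (gen_succs v) = succs (val v).
Proof.
rewrite /gen_succs pmap_filter; last exact: insubK.
apply/all_filterP/allP=> w vw; rewrite isSome_insub.
by apply: connect_trans (valP v) (connect1 _).
Qed.

Lemma size_gen_succs v : size (gen_succs v) = arity (lab (val v)).
Proof. by rewrite -size_succs -val_gen_succs size_map. Qed.

Definition gen_pregraph : pregraph := @Pregraph gen_vert gen_root _ _ size_gen_succs.

Lemma gen_edge (u v : gen_vert) : @edge gen_pregraph u v = edge (val u) (val v).
Proof. by rewrite /edge -val_gen_succs (mem_map val_inj). Qed.

Lemma gen_rooted : rooted gen_pregraph.
Proof.
move=> v; have /connectP[s es Dv] := valP v.
apply/connectP.
suff lift : forall (s : seq (vert G)) (u : gen_vert), path (@edge G) (val u) s ->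
    exists2 s', s = map val s' & path (@edge gen_pregraph) u s'.
  have [s' Ds' es'] := lift s gen_root es.
  by exists s' => //; apply: val_inj; rewrite Dv Ds' -(last_map val).
elim=> [|b t IHt] u /=; first by exists [::].
move=> /andP[ub]; have Cb : connect (@edge G) (groot G) b.
  exact: connect_trans (valP u) (connect1 ub).
move=> /(IHt (exist _ b Cb))[t' -> et'].
by exists (exist _ b Cb :: t') => //=; rewrite gen_edge ub.
Qed.

Lemma gen_guarded : guarded G -> guarded gen_pregraph.
Proof.
move=> gG c c0 /andP[cc uc].
have := gG (map val c); rewrite has_map; apply; first by case: (c) c0.
rewrite /ucycle (map_inj_uniq val_inj) uc andbT.
case: (c) cc => //= x s; rewrite -map_rcons.
move: (rcons s x) => t; elim: t x => //= y t IHt x; by rewrite gen_edge => /andP[-> /IHt].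
Qed.

Definition gen_cform (gG : guarded G) : cform :=
  Cform gen_rooted (gen_guarded gG).

End Generated.

Section Node.

Variables (l : label) (F : 'I_(arity l) -> cform).

Definition node_vert : finType := option {i : 'I_(arity l) & vert (F i)}.

Definition node_in (i : 'I_(arity l)) (v : vert (F i)) : node_vert :=
  Some (Tagged (fun i => vert (F i)) v).

Definition node_succs (u : node_vert) : seq node_vert :=
  if u is Some v then map (@node_in (tag v)) (succs (tagged v))
  else [seq node_in (groot (F i)) | i <- enum 'I_(arity l)].

Definition node_lab (u : node_vert) : label :=
  if u is Some v then lab (tagged v) else l.

Lemma size_node_succs u : size (node_succs u) = arity (node_lab u).
Proof. by case: u => [v|] /=; rewrite size_map ?size_succs ?size_enum_ord. Qed.

Definition node_pregraph : pregraph := @Pregraph node_vert None _ _ size_node_succs.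

Lemma node_in_inj i : injective (@node_in i).
Proof. by move=> x y [] /eqP; rewrite eq_Tagged => /eqP. Qed.

Lemma node_rooted : rooted node_pregraph.
Proof.
case=> [[i v]|]; last exact: connect0.
apply: (@connect_trans _ _ (node_in (groot (F i)))).
  by apply/connect1/mapP; exists i; rewrite ?mem_enum.
apply: (@connect_homo _ _ _ _ (@node_in i)) (cform_rooted v) => a b ab.
by rewrite /edge /= mem_map //; apply: node_in_inj.
Qed.

Lemma node_guarded : guarded node_pregraph.
Proof.
move=> c c0 uc.
have [x xc] : exists x, x \in c by case: (c) c0 => // x s; exists x; rewrite mem_head.
have ex : edge (prev c x) x by apply: (prev_cycle (proj1 (andP uc))).
have [i [v Dx]] : exists i v, x = @node_in i v.
  by move: ex; rewrite /edge /=; case: (prev c x) => [[i v]|] /= /mapP[w _ ->];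
     [exists i, w | exists w, (groot (F w))].
rewrite {}Dx in xc.
apply: (@guarded_embed (F i) node_pregraph (@node_in i) v c) uc xc => //.
- exact: node_in_inj.
- by move=> a b /mapP[w aw ->]; exists w.
- exact: cform_guarded.
Qed.

Definition node : cform := Cform node_rooted node_guarded.

End Node.

Definition no_arg (i : 'I_0) : cform := False_rect cform (notF (ltn_ord i)).

Definition Bot : cform := @node LBot no_arg.
Definition Top : cform := @node LTop no_arg.
Definition Var (p : nat) : cform := @node (LVar p) no_arg.
Definition Neg (phi : cform) : cform := @node LNeg (fun=> phi).
Definition Box (phi : cform) : cform := @node LBox (fun=> phi).
Definition And (phi psi : cform) : cform :=
  @node LAnd (fun i => if i == ord0 then phi else psi).
Definition Or (phi psi : cform) : cform :=
  @node LOr (fun i => if i == ord0 then phi else psi).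
Definition Imp (phi psi : cform) : cform :=
  @node LImp (fun i => if i == ord0 then phi else psi).
Definition Iff (phi psi : cform) : cform := And (Imp phi psi) (Imp psi phi).

Definition bigAnd (Gamma : seq cform) : cform := foldr And Top Gamma.

(* In subst and fixp, identifying a variable vertex v with a vertex w while
   keeping the label of w amounts, since v has no successors, to redirecting to
   w every edge into v (and the root, if it is v). The vertices v, as well as
   the copies of formulas substituted for variables that do not occur, thereby
   become unreachable and are removed by gen_cform. *)

Section Subst.

Variables (phi : cform) (I : finType) (x : I -> nat) (F : I -> cform).

Definition subst_vert : finType := (vert phi + {i : I & vert (F i)})%type.

Definition subst_in (i : I) (v : vert (F i)) : subst_vert :=
  inr (Tagged (fun i => vert (F i)) v).

Definition subst_redirect (v : vert phi) : subst_vert :=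
  if [pick i | is_var (x i) (lab v)] is Some i then subst_in (groot (F i))
  else inl v.

Definition subst_succs (u : subst_vert) : seq subst_vert :=
  match u with
  | inl v => map subst_redirect (succs v)
  | inr w => map (@subst_in (tag w)) (succs (tagged w))
  end.

Definition subst_lab (u : subst_vert) : label :=
  match u with inl v => lab v | inr w => lab (tagged w) end.

Lemma size_subst_succs u : size (subst_succs u) = arity (subst_lab u).
Proof. by case: u => v /=; rewrite size_map size_succs. Qed.

Definition subst_pregraph : pregraph :=
  @Pregraph subst_vert (subst_redirect (groot phi)) _ _ size_subst_succs.

Lemma subst_in_inj i : injective (@subst_in i).
Proof. by move=> a b [] /eqP; rewrite eq_Tagged => /eqP. Qed.

Lemma subst_guarded : guarded subst_pregraph.
Proof.
move=> c c0 uc.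
have [/hasP[[//|[i v]] xc _]|all_l] :=
  boolP (has (fun u : subst_vert => if u is inr _ then true else false) c).
  apply: (@guarded_embed (F i) subst_pregraph (@subst_in i) v c) uc xc => //.
- exact: subst_in_inj.
- by move=> a b /mapP[w aw ->]; exists w.
- exact: cform_guarded.
have {all_l} [c' Dc] : exists c' : seq (vert phi), c = map inl c'.
  elim: (c) all_l => [|u s IHs] /=; first by exists [::].
  by case: u => // v /IHs[c' ->]; exists (v :: c').
have inl_inj : injective (inl : vert phi -> subst_vert) by move=> a b [].
rewrite {c}Dc in c0 uc *; rewrite has_map.
apply: (@cform_guarded phi c'); first by case: (c') c0.
have [cc] := andP uc; rewrite /ucycle (map_inj_uniq inl_inj) => ->.
rewrite andbT; case: (c') cc => //= v s.
rewrite -(map_rcons (inl : vert phi -> subst_vert)).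
move: (rcons s v) => t; elim: t v => //= w t IHt v /andP[vw /IHt->]; rewrite andbT.
move: vw; rewrite /edge /= => /mapP[z vz].
by rewrite /subst_redirect; case: pickP => // _ [->].
Qed.

(* Simultaneous substitution of F i for the variable x i; x is meant to be
   injective. *)
Definition subst : cform := gen_cform subst_guarded.

End Subst.

Definition fam2 (I J : Type) (T : Type) (f : I -> T) (g : J -> T) (k : I + J) : T :=
  match k with inl i => f i | inr j => g j end.

Definition subst2 (phi : cform) (n m : nat)
    (s : 'I_n -> nat) (psi : 'I_n -> cform)
    (r : 'I_m -> nat) (theta : 'I_m -> cform) : cform :=
  subst phi (fam2 s r) (fam2 psi theta).

Definition modalised (p : nat) (phi : cform) : Prop :=
  forall q : seq (vert phi), path (@edge phi) (groot phi) q ->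
    is_var p (lab (last (groot phi) q)) ->
    has (fun v => is_box (lab v)) (groot phi :: q).

Section FixedPoint.

Variables (p : nat) (phi : cform).

Definition fix_redirect (v : vert phi) : vert phi :=
  if is_var p (lab v) then groot phi else v.

Definition fix_succs (v : vert phi) : seq (vert phi) :=
  map fix_redirect (succs v).

Lemma size_fix_succs v : size (fix_succs v) = arity (lab v).
Proof. by rewrite size_map size_succs. Qed.

Definition fix_pregraph : pregraph :=
  @Pregraph (vert phi) (groot phi) _ _ size_fix_succs.

Lemma fix_guarded : modalised p phi -> guarded fix_pregraph.
Proof.
move=> mod c c0 uc.
have edge_nr (a b : vert phi) : @edge fix_pregraph a b -> b != groot phi -> edge a b.
  move=> /mapP[z az ->]; rewrite /fix_redirect.
  by case: ifP => //; rewrite eqxx.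
have path_nr (s : seq (vert phi)) a :
    path (@edge fix_pregraph) a s -> groot phi \notin s -> path (@edge phi) a s.
  elim: s a => //= b s IHs a /andP[ab es]; rewrite inE negb_or eq_sym.
  by case/andP=> nb ns; rewrite (edge_nr _ _ ab nb) IHs.
have [rc|nrc] := boolP (groot phi \in c); last first.
  apply: (@cform_guarded phi c) => //; have [cc uuc] := andP uc.
  rewrite /ucycle uuc andbT; case: (c) cc nrc => //= v s cc nrc.
  by apply: path_nr; rewrite // mem_rcons.
have [i c' Dc] := rot_to rc.
have: ucycle (@edge fix_pregraph) (groot phi :: c') by rewrite -Dc rot_ucycle.
rewrite -(has_rot i) Dc => /andP[/=]; rewrite rcons_path => /andP[es el] /andP[nr _].
have {}es := path_nr _ _ es nr.
move: el => /mapP[z lz]; rewrite /fix_redirect; case: ifP => [pz _|_ Dz].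
  have := mod (rcons c' z); rewrite rcons_path es last_rcons pz => /(_ lz isT) /=.
  have nbz : is_box (lab z) = false by case: (lab z) pz.
  by rewrite has_rcons nbz.
apply: (@cform_guarded phi (groot phi :: c')) => //.
apply/andP; split; first by rewrite /= rcons_path es [X in edge _ X]Dz.
by rewrite -Dc rot_uniq; case/andP: uc.
Qed.

Definition fixp (mod : modalised p phi) : cform := gen_cform (fix_guarded mod).

End FixedPoint.

Definition fresh (phi : cform) : nat :=
  (\max_(v : vert phi) (if lab v is LVar q then q else 0)).+1.

Lemma fresh_notin (phi : cform) (v : vert phi) : ~~ is_var (fresh phi) (lab v).
Proof.
case Dl: (lab v) => [||q|||||] //=; rewrite neq_ltn ltnS.
by rewrite (bigmax_sup v) ?Dl.
Qed.

Lemma modalised_Box (p : nat) (phi : cform) : modalised p (Box phi).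
Proof. by []. Qed.

Definition BoxDot (phi : cform) : cform :=
  fixp (@modalised_Box (fresh phi) (And phi (Var (fresh phi)))).

Definition DotBoxDot (phi : cform) : cform := And phi (BoxDot phi).

Inductive pform : Type :=
| PBot | PTop | PVar of nat | PNeg of pform
| PAnd of pform & pform | POr of pform & pform | PImp of pform & pform.

Fixpoint peval (v : nat -> bool) (t : pform) : bool :=
  match t with
  | PBot => false
  | PTop => true
  | PVar q => v q
  | PNeg a => ~~ peval v a
  | PAnd a b => peval v a && peval v b
  | POr a b => peval v a || peval v b
  | PImp a b => peval v a ==> peval v b
  end.

Definition tautology (t : pform) : Prop := forall v, peval v t.

(* The substitution instance of a propositional formula has one copy of sigma q
   per occurrence of q; sharing the copies, as subst does, gives a bisimilar
   cyclic formula. *)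
Fixpoint pinst (sigma : nat -> cform) (t : pform) : cform :=
  match t with
  | PBot => Bot
  | PTop => Top
  | PVar q => sigma q
  | PNeg a => Neg (pinst sigma a)
  | PAnd a b => And (pinst sigma a) (pinst sigma b)
  | POr a b => Or (pinst sigma a) (pinst sigma b)
  | PImp a b => Imp (pinst sigma a) (pinst sigma b)
  end.

Inductive CHL : cform -> Prop :=
| CHL_taut t sigma : tautology t -> CHL (pinst sigma t)
| CHL_K (phi psi : cform) : CHL (Imp (Box (Imp phi psi)) (Imp (Box phi) (Box psi)))
| CHL_bisim (phi psi : cform) : bisimilar phi psi -> CHL (Iff phi psi)
| CHL_mp phi psi : CHL (Imp phi psi) -> CHL phi -> CHL psi
| CHL_nec phi : CHL phi -> CHL (Box phi)
| CHL_loeb phi : CHL (Imp (Box phi) phi) -> CHL phi.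

Definition derives (Gamma : seq cform) (phi : cform) : Prop :=
  CHL (Imp (bigAnd Gamma) phi).

(* Main.v *)
Require Import Defs.
From mathcomp Require Import all_boot.

Set Implicit Arguments.
Unset Strict Implicit.
Unset Printing Implicit Defensive.

(* For a vertex v of phi let A_v and B_v be the subformulas of the two
   substitution instances that correspond to v, let D be the conjunction of all
   A_v <-> B_v, let E_k range over the given equivalences and let Y be the
   conjunction of the E_k /\ BoxDot E_k. Without the edges leaving Box-labelled
   vertices phi is acyclic, and induction along the remaining edges proves
   Y /\ Box D -> D, where Box D takes care of the Box-labelled vertices. Since
   Y -> Box Y, although Box itself is not transitive, Loeb's rule yields Y -> D.
   The premises of the theorem only give Box Y, hence Box D. Repeating the
   induction on the vertices that are reachable from the root without leaving a
   Box-labelled vertex uses E_k itself only for variables in which phi is not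
   modalised. *)

(** * Bisimilarity of arbitrary vertices *)

(** Relating any two vertices, not only roots, allows local arguments; [bisimilar] is convertible to
    [sim] of the roots. *)
Definition sim (G H : pregraph) (a : vert G) (b : vert H) : Prop :=
  exists2 R : vert G -> vert H -> Prop, bisimulation R & R a b.

Lemma sim_bisimulation (G H : pregraph) : bisimulation (@sim G H).
Proof.
move=> a b [R bR /bR[Dl Rs]]; split=> // i /Rs Ri.
by exists R.
Qed.

(** Adding the pair of [a] and [b] to [sim] gives a bisimulation. *)
Lemma sim_step (G H : pregraph) (a : vert G) (b : vert H) :
  lab a = lab b ->
  (forall i, i < arity (lab a) -> sim (nth a (succs a) i) (nth b (succs b) i)) ->
  sim a b.
Proof.
move=> Dl Rs; exists (fun c d => (c = a /\ d = b) \/ sim c d); last by left.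
move=> c d [[-> ->]|/sim_bisimulation[Dl' Rs']].
  by split=> // i /Rs; right.
by split=> // i /Rs'; right.
Qed.

Lemma sim_refl (G : pregraph) (a : vert G) : sim a a.
Proof. by exists eq => // c d ->. Qed.

Lemma sim_sym (G H : pregraph) (a : vert G) (b : vert H) : sim a b -> sim b a.
Proof.
case=> R bR Rab; exists (fun d c => R c d) => // d c /bR[-> Rs].
by split.
Qed.

Lemma sim_trans (G H K : pregraph) (a : vert G) (b : vert H) (c : vert K) :
  sim a b -> sim b c -> sim a c.
Proof.
move=> ab bc; exists (fun x z => exists2 y : vert H, sim x y & sim y z); last first.
  by exists b.
move=> x z [y /sim_bisimulation[Dxy xy] /sim_bisimulation[Dyz yz]].
split=> [|i li]; first by rewrite Dxy.
by exists (nth y (succs y) i); [apply: xy | apply: yz; rewrite -Dxy].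
Qed.

(** The graph of [f] is a bisimulation. *)
Lemma sim_embed (G H : pregraph) (f : vert G -> vert H) (a : vert G) :
  (forall b, lab (f b) = lab b) -> (forall b, succs (f b) = map f (succs b)) ->
  sim a (f a).
Proof.
move=> f_lab f_succs; exists (fun b c => c = f b) => // b _ ->.
split=> [|i li]; first by rewrite f_lab.
by rewrite f_succs (nth_map b) ?size_succs.
Qed.

Lemma sim_val (G : pregraph) (v : vert (gen_pregraph G)) :
  sim v (val v : vert G).
Proof.
by apply: (@sim_embed (gen_pregraph G) G val) => // b; rewrite -val_gen_succs.
Qed.

Lemma sim_node_in (l : label) (F : 'I_(arity l) -> cform) i (v : vert (F i)) :
  sim (node_in v : vert (node F)) v.
Proof. by apply/sim_sym/(@sim_embed (F i) (node F) (@node_in l F i)). Qed.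

Lemma sim_node (G : pregraph) (v : vert G) (l : label)
    (F : 'I_(arity l) -> cform) :
  lab v = l ->
  (forall i : 'I_(arity l), sim (nth v (succs v) i) (groot (F i))) ->
  sim v (groot (node F)).
Proof.
move=> Dl vF; apply: sim_step => //= i; rewrite Dl => li.
have -> : i = Ordinal li by [].
rewrite (nth_map (Ordinal li)) ?size_enum_ord // nth_ord_enum.
exact: sim_trans (vF _) (sim_sym (sim_node_in _)).
Qed.

(** * Subformulas and the unfolding of [BoxDot] *)

Definition reroot (G : pregraph) (v : vert G) : pregraph :=
  Pregraph v (@size_succs G).

(** Guardedness does not depend on the root, so [gG] also serves for [reroot v]. *)
Definition subformula (G : pregraph) (gG : guarded G) (v : vert G) : cform :=
  @gen_cform (reroot v) gG.

Lemma sim_subformula (G : pregraph) (gG : guarded G) (v : vert G) :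
  sim (groot (subformula gG v)) v.
Proof. exact: (@sim_val (reroot v) (gen_root _)). Qed.

Lemma bisimilar_node (l : label) (F F' : 'I_(arity l) -> cform) :
  (forall i, sim (groot (F i)) (groot (F' i))) -> bisimilar (node F) (node F').
Proof.
move=> FF'; apply: sim_node => //= i; rewrite (nth_map i) ?size_enum_ord //.
by rewrite nth_ord_enum; apply: sim_trans (sim_node_in _) (FF' i).
Qed.

Lemma bisimilar_BoxDot (phi : cform) :
  bisimilar (BoxDot phi) (Box (And phi (BoxDot phi))).
Proof.
set psi := And phi (Var (fresh phi)).
set D := fix_pregraph (fresh phi) (Box psi).
have toD : sim (groot (BoxDot phi)) (groot D).
  exact: (@sim_val D (gen_root _)).
have succs_node l (F : 'I_(arity l) -> cform) (T : Type) (y : T) f i :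
    nth y (map f (succs (groot (node F)))) (nat_of_ord i) = f (node_in (groot (F i))).
  by rewrite -map_comp (nth_map i) ?size_enum_ord // nth_ord_enum.
apply: (sim_trans toD); apply: (@sim_node D _ LBox) => //= i.
rewrite succs_node.
apply: (@sim_node D _ LAnd (fun i => if i == ord0 then phi else BoxDot phi)) => // j.
rewrite -[succs _]/(map (@fix_redirect (fresh phi) (Box psi)) (map (@node_in LBox (fun=> psi) i) (succs (groot psi)))).
rewrite -map_comp succs_node ord1 /=.
case: (unliftP ord0 j) => [k|] ->; last first.
  (* [f] maps [phi] onto its copy inside [D]; as the variable is fresh, no edge of this copy is
     redirected. *)
  pose f (v : vert phi) : vert D :=
    @node_in LBox (fun=> psi) ord0
      (@node_in LAnd (fun i => if i == ord0 then phi else Var (fresh phi)) ord0 v).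
  have redirect_f v : @fix_redirect (fresh phi) (Box psi) (f v) = f v.
    by rewrite /fix_redirect /= (negbTE (fresh_notin _)).
  change (@sim D phi (@fix_redirect (fresh phi) (Box psi) (f (groot phi))) (groot phi)).
  rewrite redirect_f; apply/sim_sym/(@sim_embed phi D f) => // b.
  rewrite -[LHS]/(map (@fix_redirect (fresh phi) (Box psi))
                      (map (@node_in LBox (fun=> psi) ord0) (map _ (succs b)))).
  by rewrite -!map_comp; apply: eq_map => c; apply: redirect_f.
(* The right conjunct is the bound variable, so its edge is redirected to the root of [D]. *)
have -> : lift ord0 k = ord_max :> 'I_2 by apply: val_inj; rewrite (ord1 k).
rewrite /fix_redirect ifT ?[is_var _ _]eqxx //.
exact: sim_sym.
Qed.

(** * Propositional reasoning by reflection *)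

Ltac find_atom a l :=
  lazymatch l with
  | a :: _ => constr:(0)
  | _ :: ?l' => let n := find_atom a l' in constr:(n.+1)
  end.

Ltac add_atoms phi l :=
  lazymatch phi with
  | Imp ?a ?b => let l' := add_atoms a l in add_atoms b l'
  | And ?a ?b => let l' := add_atoms a l in add_atoms b l'
  | Or ?a ?b => let l' := add_atoms a l in add_atoms b l'
  | Iff ?a ?b => let l' := add_atoms a l in add_atoms b l'
  | Neg ?a => add_atoms a l
  | Top => l
  | Bot => l
  | _ => lazymatch l with
         | context [phi :: _] => l
         | _ => constr:(phi :: l)
         end
  end.

(** [Iff] is reified as its unfolding, so that [pinst] gives back [phi] up to conversion; boxed
    formulas count as atoms. *)
Ltac reify phi l :=
  lazymatch phi with
  | Imp ?a ?b => let s := reify a l in let t := reify b l in constr:(PImp s t)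
  | And ?a ?b => let s := reify a l in let t := reify b l in constr:(PAnd s t)
  | Or ?a ?b => let s := reify a l in let t := reify b l in constr:(POr s t)
  | Iff ?a ?b => let s := reify a l in let t := reify b l in
                 constr:(PAnd (PImp s t) (PImp t s))
  | Neg ?a => let s := reify a l in constr:(PNeg s)
  | Top => constr:(PTop)
  | Bot => constr:(PBot)
  | _ => let n := find_atom phi l in constr:(PVar n)
  end.

Ltac discharge :=
  lazymatch goal with
  | |- CHL _ -> _ =>
      let h := fresh in intro h; discharge; refine (CHL_mp _ h); clear h
  | |- CHL _ => idtac
  end.

(* Proves [CHL h1 -> ... -> CHL hk -> CHL c] when [c] is a tautological
   consequence of [h1], ..., [hk]. *)
Ltac prop :=
  discharge;
  lazymatch goal with
  | |- CHL ?phi =>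
      let l := add_atoms phi (@nil cform) in
      let t := reify phi l in
      refine (@CHL_taut t (nth Top l) _);
      let v := fresh in
      intro v; cbn [peval];
      repeat match goal with |- context [v ?n] => case: (v n) end;
      reflexivity
  end.

(** * Modal reasoning and congruence *)

Lemma CHL_Box_mono (a b : cform) : CHL (Imp a b) -> CHL (Imp (Box a) (Box b)).
Proof. by move=> /CHL_nec; apply: CHL_mp (CHL_K _ _). Qed.

Lemma CHL_Box_Iff (X a b : cform) :
  CHL (Imp X (Box (Iff a b))) -> CHL (Imp X (Iff (Box a) (Box b))).
Proof.
have ab : CHL (Imp (Iff a b) (Imp a b)) by prop.
have ba : CHL (Imp (Iff a b) (Imp b a)) by prop.
move: (CHL_Box_mono ab) (CHL_Box_mono ba) (CHL_K a b) (CHL_K b a).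
by prop.
Qed.

Lemma CHL_Box_And (a b : cform) :
  CHL (Imp (Box a) (Imp (Box b) (Box (And a b)))).
Proof.
have ab : CHL (Imp a (Imp b (And a b))) by prop.
by move: (CHL_Box_mono ab) (CHL_K b (And a b)); prop.
Qed.

Lemma CHL_Iff_node (X : cform) (l : label) (F F' : 'I_(arity l) -> cform) :
  (forall k, CHL (Imp X (if is_box l then Box (Iff (F k) (F' k))
                         else Iff (F k) (F' k)))) ->
  CHL (Imp X (Iff (node F) (node F'))).
Proof.
have nullary (F0 F1 : 'I_0 -> cform) k : F0 k = F1 k by case: k.
have two (F0 : 'I_2 -> cform) (k : 'I_2) :
    F0 k = if k == ord0 then F0 ord0 else F0 ord_max.
  by case: eqP => [->//|/eqP k0]; congr F0; apply: val_inj; case: k k0 => [[|[]]].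
have one (F0 : 'I_1 -> cform) (k : 'I_1) : F0 k = F0 ord0 by rewrite ord1.
(* A family on ordinals agrees only pointwise with the one in [Neg], [Box], [And], [Or] or [Imp];
   bisimilarity bridges the gap. *)
have Iff_eq (l1 : label) (F0 F1 : 'I_(arity l1) -> cform) :
    F0 =1 F1 -> CHL (Iff (node F0) (node F1)).
  by move=> eF; apply/CHL_bisim/bisimilar_node => i; rewrite eF; apply: sim_refl.
case: l F F' => [||q|||||] /= F F' XF.
- by move: (@Iff_eq LBot F F' (nullary _ _)); prop.
- by move: (@Iff_eq LTop F F' (nullary _ _)); prop.
- by move: (@Iff_eq (LVar q) F F' (nullary _ _)); prop.
- move: (XF ord0) (@Iff_eq LNeg F _ (one F)) (@Iff_eq LNeg F' _ (one F')).
  rewrite -!/(Neg _); prop.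
- move: (CHL_Box_Iff (XF ord0)).
  move: (@Iff_eq LBox F _ (one F)) (@Iff_eq LBox F' _ (one F')).
  rewrite -!/(Box _); prop.
- move: (XF ord0) (XF ord_max).
  move: (@Iff_eq LAnd F _ (two F)) (@Iff_eq LAnd F' _ (two F')).
  rewrite -!/(And _ _); prop.
- move: (XF ord0) (XF ord_max).
  move: (@Iff_eq LOr F _ (two F)) (@Iff_eq LOr F' _ (two F')).
  rewrite -!/(Or _ _); prop.
- move: (XF ord0) (XF ord_max).
  move: (@Iff_eq LImp F _ (two F)) (@Iff_eq LImp F' _ (two F')).
  rewrite -!/(Imp _ _); prop.
Qed.

(** * Induction on guarded graphs *)

(** Edges leaving vertices not labelled [LBox] are acyclic, so the number of vertices reachable
    along them drops at each step. *)
Lemma guarded_ind (G : pregraph) (P : vert G -> Prop) :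
  guarded G ->
  (forall v, (~~ is_box (lab v) -> forall w, edge v w -> P w) -> P v) ->
  forall v, P v.
Proof.
move=> gG stepP.
pose e : rel (vert G) := fun v w => ~~ is_box (lab v) && edge v w.
have acyclic v w : e v w -> ~~ connect e w v.
  move=> vw; apply/negP=> /connectP[p0 ep0 lp0].
  (* Removing repetitions turns the closed path into a [ucycle], to which [gG] applies. *)
  case: (shortenP ep0) lp0 => p ep up _ lp.
  have cp : cycle e (w :: p) by rewrite /= rcons_path ep -lp.
  have /hasP[u uc bu] : has (fun u => is_box (lab u)) (w :: p).
    apply: gG => //; rewrite /ucycle up andbT.
    by apply: sub_cycle cp => a b /andP[].
  (* Each vertex of the cycle has an outgoing [e]-edge, so none is labelled [LBox]. *)
  by have := next_cycle cp uc; rewrite /e bu.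
move=> v; have [k lek] := ubnP #|connect e v|.
elim: k => // k IHk in v lek *.
apply: stepP => nb w vw; apply: IHk.
have evw : e v w by rewrite /e nb.
rewrite -ltnS; apply: leq_trans lek; rewrite ltnS.
apply: proper_card; apply/properP; split.
  apply/subsetP=> u; rewrite !inE; apply: connect_trans; exact: connect1.
exists v; rewrite !inE ?connect0 //.
exact: acyclic.
Qed.

(** * Finite conjunctions *)

Lemma CHL_bigAnd_elim (T : eqType) (f : T -> cform) (s : seq T) i :
  i \in s -> CHL (Imp (bigAnd (map f s)) (f i)).
Proof.
elim: s => //= a s IHs; rewrite inE => /orP[/eqP->|/IHs]; last by prop.
by prop.
Qed.

Lemma CHL_bigAnd_intro (T : Type) (X : cform) (f : T -> cform) (s : seq T) :
  (forall i, CHL (Imp X (f i))) -> CHL (Imp X (bigAnd (map f s))).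
Proof.
move=> Xf; elim: s => [|a s]; rewrite /=; first by prop.
by move: (Xf a); prop.
Qed.

Lemma CHL_Box_bigAnd_intro (T : Type) (X : cform) (f : T -> cform) (s : seq T) :
  (forall i, CHL (Imp X (Box (f i)))) -> CHL (Imp X (Box (bigAnd (map f s)))).
Proof.
move=> Xf; elim: s => [|a s]; rewrite /=.
  have top : CHL Top by prop.
  by move: (CHL_nec top); prop.
by move: (Xf a) (CHL_Box_And (f a) (bigAnd (map f s))); prop.
Qed.

Lemma CHL_bigAnd_cat (s t : seq cform) :
  CHL (Imp (bigAnd (s ++ t)) (And (bigAnd s) (bigAnd t))).
Proof. by elim: s => [|a s] /=; prop. Qed.

Lemma CHL_BoxDot (phi : cform) : CHL (Iff (BoxDot phi) (Box (DotBoxDot phi))).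
Proof. exact: CHL_bisim (bisimilar_BoxDot phi). Qed.

(** * Subformulas of substitution instances *)

(** This is [A_v] or [B_v]. Redirection makes a substituted variable vertex stand for the root of
    the formula put in its place. *)
Definition subst_at (phi : cform) (I : finType) (x : I -> nat) (F : I -> cform)
    (v : vert phi) : cform :=
  subformula (@subst_guarded phi I x F) (subst_redirect x F v).

Lemma bisimilar_subst_at_root (phi : cform) (I : finType) (x : I -> nat)
    (F : I -> cform) :
  bisimilar (subst phi x F) (subst_at x F (groot phi)).
Proof.
apply: sim_trans (sim_sym (sim_subformula _ _)).
exact: (@sim_val (subst_pregraph phi x F) (gen_root _)).
Qed.

Lemma bisimilar_subst_at_var (phi : cform) (I : finType) (x : I -> nat)
    (F : I -> cform) (v : vert phi) (i : I) :
  [pick j | is_var (x j) (lab v)] = Some i -> bisimilar (subst_at x F v) (F i).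
Proof.
move=> vi; apply: sim_trans (sim_subformula _ _) _.
rewrite /subst_redirect vi.
exact/sim_sym/(@sim_embed (F i) (subst_pregraph phi x F) (@subst_in phi I F i)).
Qed.

Lemma bisimilar_subst_at_node (phi : cform) (I : finType) (x : I -> nat)
    (F : I -> cform) (v : vert phi) :
  [pick j | is_var (x j) (lab v)] = None ->
  bisimilar (subst_at x F v)
    (@node (lab v) (fun k => subst_at x F (nth v (succs v) k))).
Proof.
move=> v0; apply: sim_trans (sim_subformula _ _) _.
rewrite /subst_redirect v0.
apply: (@sim_node (subst_pregraph phi x F) _ (lab v)) => //= k.
rewrite (nth_map v) ?size_succs //.
exact: sim_sym (sim_subformula (@subst_guarded phi I x F) _).
Qed.

(** * Replacement of equivalents *)

(** The induction is needed twice: with [U] all vertices, and with [U] those reached from the root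
    without leaving a box. *)
Lemma CHL_Iff_subst_at (phi : cform) (I : finType) (x : I -> nat)
    (F G : I -> cform) (X : cform) (U : vert phi -> Prop) :
  (forall v w, U v -> ~~ is_box (lab v) -> edge v w -> U w) ->
  (forall v i, U v -> is_var (x i) (lab v) -> CHL (Imp X (Iff (F i) (G i)))) ->
  (forall v : vert phi,
     CHL (Imp X (Box (Iff (subst_at x F v) (subst_at x G v))))) ->
  forall v, U v -> CHL (Imp X (Iff (subst_at x F v) (subst_at x G v))).
Proof.
move=> U_edge U_var X_box; apply: (guarded_ind (@cform_guarded phi)) => v IHv Uv.
(* The pick depends only on [x] and [lab v], so both instances redirect [v] to the same index. *)
case Dpick: [pick j | is_var (x j) (lab v)] => [i|].
  have xi : is_var (x i) (lab v) by case: pickP Dpick => // j xj [<-].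
  move: (U_var v i Uv xi).
  move: (CHL_bisim (bisimilar_subst_at_var F Dpick)).
  by move: (CHL_bisim (bisimilar_subst_at_var G Dpick)); prop.
move: (CHL_bisim (bisimilar_subst_at_node F Dpick)).
move: (CHL_bisim (bisimilar_subst_at_node G Dpick)).
set FN := node _; set GN := node _.
have : CHL (Imp X (Iff GN FN)).
  apply: CHL_Iff_node => k; have kv : edge v (nth v (succs v) k).
    by rewrite /edge mem_nth ?size_succs.
  case: ifPn => [_|nb].
    exact: X_box.
  by apply: IHv => //; apply: U_edge kv.
by prop.
Qed.

Lemma CHL_Iff_subst (phi : cform) (I : finType) (x : I -> nat)
    (F G : I -> cform) (X : cform) :
  (forall i, CHL (Imp X (BoxDot (Iff (F i) (G i))))) ->
  (forall i, ~ modalised (x i) phi -> CHL (Imp X (Iff (F i) (G i)))) ->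
  CHL (Imp X (Iff (subst phi x F) (subst phi x G))).
Proof.
move=> X_box X_now.
pose E i := Iff (F i) (G i).
pose Y := bigAnd [seq DotBoxDot (E i) | i <- enum I].
pose e (v : vert phi) := Iff (subst_at x F v) (subst_at x G v).
pose D := bigAnd [seq e v | v <- enum (vert phi)].
have YE i : CHL (Imp Y (DotBoxDot (E i))).
  by apply: CHL_bigAnd_elim; rewrite mem_enum.
have De v : CHL (Imp (Box D) (Box (e v))).
  by apply/CHL_Box_mono/CHL_bigAnd_elim; rewrite mem_enum.
(* Unfolding [BoxDot] puts the whole of [DotBoxDot (E i)] under a box. *)
have Y_Box : CHL (Imp Y (Box Y)).
  apply: CHL_Box_bigAnd_intro => i.
  by move: (YE i) (CHL_BoxDot (E i)); rewrite /DotBoxDot; prop.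
have X_Box : CHL (Imp X (Box Y)).
  apply: CHL_Box_bigAnd_intro => i.
  by move: (X_box i) (CHL_BoxDot (E i)); rewrite -/(E i); prop.
have YD : CHL (Imp (And Y (Box D)) D).
  apply: CHL_bigAnd_intro => v.
  apply: (@CHL_Iff_subst_at _ _ _ _ _ _ (fun=> True)) => // [w i _ _|w].
    by move: (YE i); rewrite /DotBoxDot -/(E i); prop.
  by move: (De w); rewrite -/(e w); prop.
have {}YD : CHL (Imp Y D).
  (* From [Box (Imp Y D)] and [Y], [Box Y] yields [Box D], and hence [D]. *)
  by apply: CHL_loeb; move: YD Y_Box (CHL_K Y D); prop.
have XD v : CHL (Imp X (Box (e v))).
  by move: X_Box (CHL_Box_mono YD) (De v); prop.
(* [belast] omits the endpoint, so [v] itself may be labelled [LBox]. *)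
pose U (v : vert phi) := exists2 q, path (@edge phi) (groot phi) q &
  v = last (groot phi) q /\ ~~ has (fun w => is_box (lab w)) (belast (groot phi) q).
have : CHL (Imp X (e (groot phi))).
  apply: (@CHL_Iff_subst_at _ _ _ _ _ _ U) => //; last by exists [::].
  - move=> v w [q pq [Dv nq]] nv vw; exists (rcons q w).
      by rewrite rcons_path pq -Dv.
    rewrite last_rcons belast_rcons lastI has_rcons -Dv negb_or nv.
    by split.
  - move=> v i [q pq [Dv nq]] xi; apply: X_now => mod.
    (* Modalisation would put a box on [q], but there is none before [v], and [v] carries a
       variable. *)
    have := mod q pq; rewrite -Dv lastI has_rcons -Dv => /(_ xi).
    by rewrite (negbTE nq) orbF; case: (lab v) xi.
rewrite /e.
move: (CHL_bisim (bisimilar_subst_at_root phi x F)).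
by move: (CHL_bisim (bisimilar_subst_at_root phi x G)); prop.
Qed.

Theorem theorem3p6 (n m : nat) (s : 'I_n -> nat) (r : 'I_m -> nat)
    (distinct_sr : injective (fam2 s r))
    (phi : cform) (phi_mod : forall j : 'I_m, modalised (r j) phi)
    (psi chi : 'I_n -> cform) (theta rho : 'I_m -> cform) :
  derives
    ([seq DotBoxDot (Iff (psi i) (chi i)) | i <- enum 'I_n]
     ++ [seq BoxDot (Iff (theta j) (rho j)) | j <- enum 'I_m])
    (Iff (subst2 phi s psi r theta) (subst2 phi s chi r rho)).
Proof.
rewrite /derives; set S := map _ _; set T := map _ _.
have S_elim i : CHL (Imp (bigAnd (S ++ T)) (DotBoxDot (Iff (psi i) (chi i)))).
  have : CHL (Imp (bigAnd S) (DotBoxDot (Iff (psi i) (chi i)))).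
    by apply: CHL_bigAnd_elim; rewrite mem_enum.
  by move: (CHL_bigAnd_cat S T); prop.
have T_elim j : CHL (Imp (bigAnd (S ++ T)) (BoxDot (Iff (theta j) (rho j)))).
  have : CHL (Imp (bigAnd T) (BoxDot (Iff (theta j) (rho j)))).
    by apply: CHL_bigAnd_elim; rewrite mem_enum.
  by move: (CHL_bigAnd_cat S T); prop.
(* For [r j] the case of non-modalised variables is vacuous by [phi_mod]. *)
apply: CHL_Iff_subst => [[i|j]|[i _|j /(_ (phi_mod j)) //]] /=; last 1 first.
- by move: (S_elim i); rewrite /DotBoxDot; prop.
- by move: (S_elim i); rewrite /DotBoxDot; prop.
- exact: T_elim.
Qed.
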